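(* Let $(X,d)$ be a complete metric space. Let the set-valued map $S:X\rightrightarrows X$ be idempotent and with closed values. Let $x_0\in X$. Then at least one of the following two holds: (a) There is an $S$-orbit of finite length starting at $x_0$ and ending at such $x\in X$ that $S(x)\subset\{x\}$; (b) There is an $S$-orbit of infinite length starting at $x_0$.
   Context: A set-valued map $S:X\rightrightarrows X$ assigns to each $x\in X$ a (possibly empty) subset $S(x)\subset X$; closed values means each $S(x)$ is closed. $S$ is idempotent if $S(S(x))=\bigcup_{y\in S(x)}S(y)\subset S(x)$ for all $x\in X$. An $S$-orbit starting at $x_0$ is a finite ($x_0,\dots,x_n$, $n\ge 0$) or infinite ($x_0,x_1,\dots$) succession of points with $x_{i+1}\in S(x_i)$ for all relevant $i$. It ends at $x$ if it is finite with last point $x$, or it is infinite and converges to $x$. The length of an orbit is $\sum_i d(x_{i+1},x_i)$, the sum over all consecutive pairs (so a finite orbit always has finite length). *)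

(* Defs.v *)
From HB Require Import structures.
From mathcomp Require Import all_boot all_order all_algebra.
From mathcomp Require Import boolp classical_sets reals ereal.
From mathcomp Require Import topology normedtype sequences.

Set Implicit Arguments.
Unset Strict Implicit.
Unset Printing Implicit Defensive.

Import Order.TTheory GRing.Theory Num.Theory.

Local Open Scope classical_set_scope.
Local Open Scope ring_scope.

(* [Complete] carries a distinguished point, i.e. the space is nonempty. *)
#[short(type="completeMetricType")]
HB.structure Definition CompleteMetric (R : numDomainType) :=
  {X of Complete X & Metric R X}.

Definition idempotent_map (X : Type) (S : X -> set X) : Prop :=
  forall x, \bigcup_(y in S x) S y `<=` S x.

Definition closed_valued (X : topologicalType) (S : X -> set X) : Prop :=
  forall x, closed (S x).

(* [FinSucc x s] is the finite succession [x :: s], which has [size s] steps;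
   [s] may be empty. *)
Inductive succession (X : Type) : Type :=
| FinSucc of X & seq X
| InfSucc of nat -> X.

Definition start (X : Type) (o : succession X) : X :=
  match o with
  | FinSucc x _ => x
  | InfSucc u => u 0%N
  end.

Definition is_orbit (X : Type) (S : X -> set X) (o : succession X) : Prop :=
  match o with
  | FinSucc x s => path (fun y z => z \in S y) x s
  | InfSucc u => forall i, S (u i) (u i.+1)
  end.

Definition ends_at (X : topologicalType) (o : succession X) (x : X) : Prop :=
  match o with
  | FinSucc y s => last y s = x
  | InfSucc u => u @ \oo --> x
  end.

Definition orbit_length (R : realType) (X : metricType R) (o : succession X) :
    \bar R :=
  match o with
  | FinSucc x s => (\sum_(r <- pairmap (fun y z => mdist z y) x s) r%:E)%E
  | InfSucc u => (\sum_(0 <= i <oo) (mdist (u i.+1) (u i))%:E)%E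
  end.

(* Main.v *)
Require Import Defs.
From mathcomp Require Import all_boot all_order all_algebra.
From mathcomp Require Import boolp classical_sets reals ereal.
From mathcomp Require Import topology normedtype sequences.
From mathcomp Require Import lra.

(** If no orbit issued from [x0] has infinite length, follow a greedy orbit [u]:
    its [n]-th step is at least half of [min (1, d (u n, z))] for every [z] in
    [S (u n)].  The truncation at 1 makes such a step exist even when [S (u n)]
    is unbounded.  Unless it gets stuck at a point where [S] is empty, [u] is
    infinite of finite length, hence converges to some [x] and its steps tend to
    0.  By idempotence and closedness [x] and [S x] lie in every [S (u n)], so
    greediness forces [u] to converge to every [z] in [S x]; thus [z = x]. *)

Import Order.TTheory GRing.Theory Num.Theory.
Import numFieldNormedType.Exports.

Local Open Scope classical_set_scope.
Local Open Scope ring_scope.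

Lemma mdist_le_sum (R : realFieldType) (X : metricType R) (u : nat -> X)
    (m n : nat) :
  (m <= n)%N -> mdist (u m) (u n) <= \sum_(m <= i < n) mdist (u i.+1) (u i).
Proof.
elim: n => [|n IHn]; first by rewrite leqn0 => /eqP ->; rewrite mdistxx big_geq.
rewrite leq_eqVlt => /predU1P[->|]; first by rewrite mdistxx big_geq.
rewrite ltnS => le_mn; rewrite big_nat_recr//=.
apply: le_trans (metric_triangle _ (u n) _) _.
by rewrite lerD ?IHn// metric_sym.
Qed.

(** By the triangle inequality, a tail of the series dominates [mdist (u N) (u n)], so [u] is
    Cauchy. *)
Lemma cvg_finite_length (R : realType) (X : completeMetricType R)
    (u : nat -> X) :
  cvgn (series (fun i => mdist (u i.+1) (u i))) -> cvgn u.
Proof.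
move=> /cvg_cauchy/cauchyP; set s := series _ => cs.
apply: cauchy_cvg; apply: cauchy_exP => e e0.
(* From [N] on, the partial sums are within [e / 2] of [l], hence within [e] of each other. *)
have [l /= [N _ sN]] := cs _ (divr_gt0 e0 (ltr0n _ 2)).
exists (u N); exists N => // n /= le_Nn.
rewrite ballEmdist /=; apply: le_lt_trans (mdist_le_sum _ _ _ _ _ le_Nn) _.
have := sN _ le_Nn; have := sN _ (leqnn N).
rewrite -ball_normE /= => sNl snl.
rewrite [X in X < _](_ : _ = s n - s N); last by rewrite sub_series_geq.
move: sNl snl; rewrite !ltr_norml => /andP[? ?] /andP[? ?]; lra.
Qed.

Lemma near_farthest_point (R : realType) (X : metricType R) (A : set X)
    (x : X) :
  A !=set0 ->
  exists2 y, A y & forall z, A z -> Num.min 1 (mdist x z) <= 2 * mdist x y.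
Proof.
move=> [a Aa]; pose E := [set Num.min 1 (mdist x z) | z in A].
have ubE : ubound E 1 by move=> _ [z _ <-]; rewrite ge_min lexx.
have supE : has_sup E by split; [exists (Num.min 1 (mdist x a)), a|exists 1].
have le_sup z : A z -> Num.min 1 (mdist x z) <= sup E.
  by move=> Az; apply: ub_le_sup; [exists 1|exists z].
(* A value above half of [sup E] exists only if [sup E] is positive; otherwise any point of [A] will
   do. *)
have [sup_le0|sup_gt0] := leP (sup E) 0.
  exists a => // z /le_sup le_z; apply: le_trans le_z _.
  by rewrite (le_trans sup_le0)// mulr_ge0// mdist_ge0.
have [_ [y Ay <-]] := sup_adherent (divr_gt0 sup_gt0 (ltr0n _ 2)) supE.
rewrite lt_min => /andP[_ ?]; exists y => // z /le_sup le_z.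
by apply: le_trans le_z _; lra.
Qed.

Lemma idempotent_orbit (X : Type) (S : X -> set X) (u : nat -> X) (m n : nat) :
  idempotent_map S -> (forall i, S (u i) (u i.+1)) -> (m < n)%N ->
  S (u m) (u n).
Proof.
move=> S_idem Su; elim: n => [//|n IHn]; rewrite ltnS leq_eqVlt.
move=> /predU1P[->//|/IHn Smn]; apply: S_idem; exists (u n) => //; exact: Su.
Qed.

Lemma greedy_orbit_limit (R : realType) (X : metricType R) (S : X -> set X)
    (u : nat -> X) (x : X) :
  idempotent_map S -> closed_valued S -> (forall i, S (u i) (u i.+1)) ->
  (forall i z, S (u i) z ->
     Num.min 1 (mdist (u i) z) <= 2 * mdist (u i) (u i.+1)) ->
  (fun i => mdist (u i.+1) (u i)) @ \oo --> (0 : R) ->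
  u @ \oo --> x -> S x `<=` [set x].
Proof.
move=> S_idem S_closed Su greedy steps0 ux z Sxz /=.
apply: (cvg_unique (@metric_hausdorff _ _) _ ux); apply/cvg_ballP => e e0.
(* The terms after [u n] lie in the closed set [S (u n)], and so does their limit; [u n] itself need
   not, hence the start at [n.+1]. *)
have Sux n : S (u n) x.
  apply: (closed_cvg _ (S_closed (u n)) _ _ ux); exists n.+1 => // m /= lt_nm.
  exact: (idempotent_orbit _ _ _ _ _ S_idem Su lt_nm).
(* The half absorbs the factor 2 of [greedy]; the cap at 1 keeps the truncated distance below 1,
   where it equals the true distance. *)
have me0 : 0 < Num.min 1 e / 2 by rewrite divr_gt0// lt_min ltr01.
have [N _ stepN] := (cvgrPdist_lt _ _).1 steps0 _ me0; exists N => // n /= Nn.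
apply: ball_sym; rewrite ballEmdist /=.
have Sunz : S (u n) z by apply: S_idem; exists x.
have := stepN _ Nn; rewrite /= sub0r normrN ger0_norm ?mdist_ge0//.
rewrite ltr_pdivlMr// => step_lt.
have : Num.min 1 (mdist (u n) z) < Num.min 1 e.
  by apply: le_lt_trans (greedy _ _ Sunz) _; rewrite mulrC metric_sym.
rewrite lt_min !gt_min ltxx /=; case/andP=> lt1 /orP[lt1e|//].
exact: lt_trans lt1 lt1e.
Qed.

Theorem theorem4p3 (R : realType) (X : completeMetricType R) (S : X -> set X)
    (S_idem : idempotent_map S) (S_closed : closed_valued S) (x0 : X) :
  (exists (o : succession X) (x : X),
     [/\ is_orbit S o, start o = x0, (orbit_length o < +oo)%E,
         ends_at o x & S x `<=` [set x]])
  \/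
  (exists o : succession X,
     [/\ is_orbit S o, start o = x0 & orbit_length o = +oo%E]).
Proof.
(* Where [S x] is empty, [f] takes the junk value [x], so [u] is an orbit only as long as it is not
   stuck. *)
have /choice [f fP] : forall x, exists y, S x !=set0 ->
    S x y /\ forall z, S x z -> Num.min 1 (mdist x z) <= 2 * mdist x y.
  move=> x; have [/near_farthest_point-/(_ x)[y Sxy yP]|nS] :=
    pselect (S x !=set0); first by exists y.
  by exists x => /nS.
pose u n := iter n f x0.
have [[n stuck_n]|/forallNP never_stuck] :=
    pselect (exists n, ~ (S (u n) !=set0)); last first.
  have uP n : S (u n) (u n.+1) /\ forall z, S (u n) z ->
      Num.min 1 (mdist (u n) z) <= 2 * mdist (u n) (u n.+1).
    by apply: (fP (u n)); apply: contrapT; exact: never_stuck.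
  have Su n := (uP n).1.
  have [len_oo|len_fin] := eqVneq (orbit_length (InfSucc u)) +oo%E.
    by right; exists (InfSucc u).
  left; exists (InfSucc u), (limn u).
  have len_lty : (orbit_length (InfSucc u) < +oo)%E by rewrite ltey.
  have cvg_len : cvgn (series (fun i => mdist (u i.+1) (u i))).
    by apply: nnseries_is_cvg => // i; exact: mdist_ge0.
  have cvg_u := cvg_finite_length _ _ _ cvg_len.
  split=> //; apply: (greedy_orbit_limit _ _ _ u) => //.
  - by move=> i; exact: (uP i).2.
  - exact: cvg_series_cvg_0.
(* With the least stuck index [m], each [S (u k)] with [k < m] is nonempty, so all steps up to [u m]
   are genuine. *)
left; have [m stuck_m min_m] := ex_minnP (ex_intro
  (fun n => `[< ~ (S (u n) !=set0) >]) n (asboolT stuck_n)).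
exists (FinSucc x0 (traject f (f x0) m)), (u m); split => //.
- suff: forall k, (k <= m)%N ->
      path (fun y z => z \in S y) x0 (traject f (f x0) k) by exact.
  elim=> [//|k IHk lt_km]; rewrite trajectSr rcons_path (IHk (ltnW lt_km))/=.
  rewrite last_traject -iterSr iterS inE; apply: (fP _ _).1.
  by apply: contrapT => /asboolT /min_m; rewrite leqNgt lt_km.
- by rewrite /= sumEFin ltry.
- by rewrite /= last_traject.
- by move/asboolP: stuck_m => stuck_m z Sz; case: stuck_m; exists z.
Qed.
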